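(* For every $\epsilon>0$ there is an integer $k_0$ such that for every fixed integer $k\geq k_0$, \[\theta_\mathbb{R}(d,k)\leq(1+o(1))\frac{(1+\epsilon)\sqrt{k}}{d},\] where $o(1)\to0$ as $d\to\infty$.
   Context: For positive integers $d,k$, $\theta_\mathbb{R}(d,k):=\min \max_{i\neq j}|\langle x_i,x_j\rangle|$ over all choices of $d+k$ unit vectors $x_1,\dots,x_{d+k}\in\mathbb{R}^d$. *)

(* Defs.v *)
From HB Require Import structures.
From mathcomp Require Import all_boot all_order all_algebra.
From mathcomp Require Import all_classical all_reals all_analysis.
Set Implicit Arguments.
Unset Strict Implicit.
Unset Printing Implicit Defensive.
Import Order.TTheory GRing.Theory Num.Theory.
Import numFieldNormedType.Exports.
Local Open Scope classical_set_scope.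
Local Open Scope ring_scope.

(* The Euclidean inner product on R^d. The norm `|x| that the library puts on
   'rV[R]_d is the sup norm, so unit vectors are defined from [dotp]. *)
Definition dotp (R : realType) (d : nat) (x y : 'rV[R]_d) : R :=
  \sum_(j < d) x 0 j * y 0 j.

Definition unit_vector (R : realType) (d : nat) (x : 'rV[R]_d) : Prop :=
  Num.sqrt (dotp x x) = 1.

(* The terms are nonnegative, so starting the maximum at 0 is harmless when
   n >= 2; for n <= 1 there are no pairs and the value is 0. *)
Definition coherence (R : realType) (d n : nat) (x : 'I_n -> 'rV[R]_d) : R :=
  \big[Num.max/0]_(i < n) \big[Num.max/0]_(j < n | i != j) `|dotp (x i) (x j)|.

Definition coherences (R : realType) (d n : nat) : set R :=
  [set coherence x | x in [set x : 'I_n -> 'rV[R]_d |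
                           forall i, unit_vector (x i)]].
Arguments coherences : clear implicits.

(* For 0 < d the infimum is attained: see [thetaR_le] and [thetaR_min]. *)
Definition thetaR (R : realType) (d k : nat) : R := inf (coherences R d (d + k)).
Arguments thetaR : clear implicits.

Lemma unit_vectorE (R : realType) (d : nat) (x : 'rV[R]_d) :
  unit_vector x <-> dotp x x = 1.
Proof.
have d0 : 0 <= dotp x x by apply: sumr_ge0 => j _; rewrite -expr2 sqr_ge0.
split=> [h|]; last by rewrite /unit_vector => ->; rewrite sqrtr1.
by rewrite -(sqr_sqrtr d0) h expr1n.
Qed.

Lemma coherence_ge0 (R : realType) (d n : nat) (x : 'I_n -> 'rV[R]_d) :
  0 <= coherence x.
Proof.
rewrite /coherence; elim/big_ind: _ => // [a b a0 b0|i _].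
  by rewrite le_max a0.
by elim/big_ind: _ => // a b a0 b0; rewrite le_max a0.
Qed.

Lemma thetaR_le (R : realType) (d k : nat) (x : 'I_(d + k) -> 'rV[R]_d) :
  (forall i, unit_vector (x i)) -> thetaR R d k <= coherence x.
Proof.
move=> ux; apply: ge_inf; last by exists x.
by exists 0 => _ [y _ <-]; exact: coherence_ge0.
Qed.

Lemma continuous_bigmax (R : realType) (T : topologicalType) (I : Type)
    (r : seq I) (P : pred I) (f : I -> T -> R) :
  (forall i, continuous (f i)) ->
  continuous (fun t => \big[Num.max/0]_(i <- r | P i) f i t).
Proof.
move=> cf; elim: r => [|i r IH] t.
  by under eq_fun do rewrite big_nil; exact: cvg_cst.
under eq_fun do rewrite big_cons; case: (P i); last exact: IH.
exact: (@continuous_max R T (f i) _ t (cf i t) (IH t)).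
Qed.

Lemma thetaR_min (R : realType) (d k : nat) : (0 < d)%N ->
  exists2 x : 'I_(d + k) -> 'rV[R]_d,
    (forall i, unit_vector (x i)) & coherence x = thetaR R d k.
Proof.
move=> d0; set n := (d + k)%N.
pose V := 'rV[R]_(n * d).
pose F (v : V) (i : 'I_n) : 'rV[R]_d := row i (vec_mx v).
have FE v i j : F v i 0 j = v 0 (mxvec_index i j) by rewrite !mxE.
have cc l : continuous (fun v : V => v 0 l) by exact: coord_continuous.
have cdot i j : continuous (fun v : V => dotp (F v i) (F v j)).
  apply: continuous_big => [|l _]; first exact: add_continuous.
  under eq_fun do rewrite !FE.
  by move=> v; exact: (cvgM (cc _ v) (cc _ v)).
pose A := [set v : V | forall i, unit_vector (F v i)].
have cA : compact A.
  pose B := [set v : V | forall l, `[-1, 1]%classic (v ord0 l)].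
  have cB : compact B.
    exact: (@rV_compact R _ (fun=> `[-1, 1]%classic) (fun=> @segment_compact R _ _)).
  apply: (subclosed_compact _ cB) => [|v Av l /=].
  - rewrite (_ : A = \bigcap_i ((fun v : V => dotp (F v i) (F v i)) @^-1`
                                  [set c | c = 1])).
      apply: closed_bigI => i _; apply: preimage_closed; last exact: closed_eq.
      by move=> v _; exact: cdot.
    apply/seteqP; split=> v Av i; first by move=> _; apply/unit_vectorE.
    by apply/unit_vectorE; exact: Av.
  - case/mxvec_indexP: l => i j.
    have /unit_vectorE := Av i; rewrite /dotp (bigD1 j) //= !FE => h.
    rewrite in_itv /= -ler_norml -(@expr_le1 _ 2) // real_normK ?num_real // -h.
    by rewrite expr2 lerDl sumr_ge0 // => j' _; rewrite -expr2 sqr_ge0.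
have A0 : A !=set0.
  exists (mxvec (\matrix_(i < n, j < d) (j == Ordinal d0)%:R)) => i.
  apply/unit_vectorE; rewrite /dotp (bigD1 (Ordinal d0)) //= big1 ?FE.
    by rewrite mxvecE mxE eqxx mulr1 addr0.
  by move=> j /negbTE j0; rewrite !FE mxvecE mxE j0 mul0r.
have cf : continuous (fun v : V => coherence (F v)).
  apply: continuous_bigmax => i; apply: continuous_bigmax => j v.
  exact: (cvg_norm (cdot i j v)).
have [c cinA cmin] := compact_EVT_min A0 cA (continuous_subspaceT cf).
rewrite inE in cinA; exists (F c) => //; apply/eqP; rewrite eq_le thetaR_le // andbT.
apply: lb_le_inf; first by exists (coherence (F c)), (F c).
move=> _ [x ux <-].
suff [v -> vA] : exists2 v : V, x = F v & v \in A by exact: cmin.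
have xF : x = F (mxvec (\matrix_(i < n) x i)).
  by apply/funext => i; apply/rowP => j; rewrite FE mxvecE mxE.
by exists (mxvec (\matrix_(i < n) x i)); rewrite // inE /A /= -xF.
Qed.

(* Main.v *)
Require Import Defs.
From HB Require Import structures.
From mathcomp Require Import all_boot all_order all_algebra.
From mathcomp Require Import all_classical all_reals all_analysis.
From mathcomp Require Import ring lra.
Import Order.TTheory GRing.Theory Num.Theory.
Import numFieldNormedType.Exports.
Local Open Scope classical_set_scope.
Local Open Scope ring_scope.

(* Take a transversal design over a finite ring X with r elements: the points
   are the pairs (a, c) with 1 <= a <= s and c in X, the blocks are the pairs
   (x, y), and (x, y) lies on (a, c) when c = f a * x + y. Differences of slopes
   f a are units, so two points share at most one block. To each point attach M
   vectors in R^(X * X), supported on the r blocks through it, whose entries are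
   the columns of an r x M sign matrix with orthogonal rows. The block-by-vector
   matrix Z has orthogonal rows; let G be the Gram matrix Z^T Z with the inner
   products between vectors of a common point replaced by 0. Then G has entries
   in {-1, 0, 1}, and its largest eigenvalue is (s - 1) M, on the row space of Z,
   of dimension r^2. Hence 1 - G / ((s - 1) M) is the Gram matrix of s r M unit
   vectors in codimension r^2, of coherence
   1 / ((s - 1) M) = (s / (s - 1)) r / (s r M). With s large, r just above
   sqrt k and M proportional to d this is the required bound. *)

(** * Realizing Gram matrices in a space of small dimension *)

Lemma dotpE (R : realType) (d : nat) (x y : 'rV[R]_d) :
  dotp x y = (x *m y^T) 0 0.
Proof. by rewrite /dotp !mxE; apply: eq_bigr => j _; rewrite mxE. Qed.

Lemma dotp_eq0 (R : realType) (d : nat) (x : 'rV[R]_d) :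
  (dotp x x == 0) = (x == 0).
Proof.
apply/eqP/eqP => [xx0|->]; last by rewrite dotpE mul0mx mxE.
apply/rowP => j; rewrite mxE; apply/eqP; rewrite -sqrf_eq0 expr2.
have := xx0; rewrite /dotp => /eqP.
rewrite psumr_eq0 => [/allP/(_ j (mem_index_enum _)) //|i _].
by rewrite -expr2 sqr_ge0.
Qed.

(** Householder reflection along [w = v - e], or the identity when [v = e]. It serves to rotate a
    kernel vector onto a coordinate axis. *)
Lemma exists_reflection (R : realType) (q : nat) (v e : 'rV[R]_q) :
  dotp v v = 1 -> dotp e e = 1 ->
  exists2 H : 'M[R]_q, H *m H^T = 1%:M & e *m H^T = v.
Proof.
move=> vv ee; pose w := v - e.
pose H : 'M[R]_q := 1%:M - (2 / dotp w w) *: (w^T *m w).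
have mx11 (A : 'M[R]_1) : A = (A 0 0)%:M by exact: mx11_scalar.
have HT : H^T = H.
  by rewrite /H linearB /= linearZ /= trmx1 trmx_mul trmxK.
have ww : dotp w w = 2 - 2 * dotp e v.
  have ev : dotp v e = dotp e v.
    by rewrite /dotp; apply: eq_bigr => j _; rewrite mulrC.
  have -> : dotp w w = dotp v v - dotp v e - dotp e v + dotp e e.
    rewrite /dotp -!sumrB -big_split /=; apply: eq_bigr => j _.
    by rewrite !mxE; ring.
  by rewrite vv ee ev; ring.
have [w0|wN0] := eqVneq (dotp w w) 0.
  exists 1%:M; first by rewrite trmx1 mulmx1.
  move/eqP: w0; rewrite dotp_eq0 subr_eq0 => /eqP->.
  by rewrite trmx1 mulmx1.
exists H; rewrite HT.
  have wwE : w *m w^T = (dotp w w)%:M by rewrite dotpE -mx11.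
  rewrite /H mulmxBr mulmx1 mulmxBl mul1mx -scalemxAl -scalemxAr scalerA.
  rewrite mulmxA -(mulmxA w^T) wwE mul_mx_scalar -scalemxAl scalerA.
  rewrite -!addrA -[RHS]addr0; congr (_ + _); rewrite opprB -scalerBl -scaleNr -scalerDl.
  by rewrite [X in X *: _](_ : _ = 0) ?scale0r //; field.
rewrite /H mulmxBr mulmx1 -scalemxAr mulmxA (mx11 (e *m w^T)) -dotpE.
rewrite mul_scalar_mx scalerA.
have -> : dotp e w = - (dotp w w / 2).
  have -> : dotp e w = dotp e v - dotp e e.
    by rewrite /dotp -sumrB; apply: eq_bigr => j _; rewrite !mxE mulrBr.
  by rewrite ww ee; field.
rewrite [X in X *: _](_ : _ = -1); last by field.
by rewrite scaleN1r opprK /w addrC subrK.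
Qed.

(** While [B] has more than [d] columns, some unit [v] satisfies [v *m B^T = 0]. An orthogonal [H]
    aligning the first axis with [v] makes the first column of [B *m H] zero, and dropping it keeps
    the Gram matrix. *)
Lemma gram_rank (R : realType) (n q d : nat) (B : 'M[R]_(n, q)) :
  (\rank B <= d)%N ->
  exists B' : 'M[R]_(n, d), B' *m B'^T = B *m B^T.
Proof.
elim: q B => [|q IH] B rB.
  by exists 0; rewrite mul0mx [B]thinmx0 mul0mx.
have [qd|dq] := leqP q.+1 d.
  rewrite -(subnKC qd); exists (row_mx B 0).
  by rewrite tr_row_mx mul_row_col mul0mx addr0.
have [u uN0 uB] : exists2 u : 'rV[R]_q.+1, u != 0 & u *m B^T = 0.
  have : kermx B^T != 0.
    rewrite kermx_eq0 /row_free mxrank_tr neq_ltn.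
    by rewrite (leq_ltn_trans rB dq).
  by case/rowV0Pn => u /sub_kermxP uB uN0; exists u.
pose v := (Num.sqrt (dotp u u))^-1 *: u.
have uu0 : 0 < dotp u u.
  rewrite lt_def dotp_eq0 uN0 /=.
  by apply: sumr_ge0 => j _; rewrite -expr2 sqr_ge0.
have vv : dotp v v = 1.
  rewrite dotpE /v linearZ /= -scalemxAl -scalemxAr scalerA mxE -dotpE.
  rewrite -{3}(sqr_sqrtr (ltW uu0)); field.
  by rewrite gt_eqF // sqrtr_gt0.
pose e : 'rV[R]_q.+1 := delta_mx 0 0.
have ee : dotp e e = 1.
  by rewrite dotpE /e trmx_delta mul_delta_mx mxE eqxx.
have [H HH eH] := exists_reflection _ _ _ _ vv ee.
pose B1 : 'M[R]_(n, 1 + q) := B *m H.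
have B1e : lsubmx B1 = 0.
  have : B1 *m e^T = 0.
    rewrite /B1 -mulmxA -[H]trmxK -trmx_mul eH /v linearZ /= -scalemxAr.
    by rewrite -[B]trmxK -trmx_mul uB trmx0 scaler0.
  rewrite /e trmx_delta -colE => B1e; apply/matrixP => i j.
  have := congr1 (fun M : 'cV[R]_n => M i 0) B1e.
  by rewrite !mxE ord1 (_ : lshift q 0 = 0) //; apply/val_inj.
have [|B' B'E] := IH (rsubmx B1).
  by rewrite /B1 -mulmx_rsub (leq_trans (mxrankM_maxl _ _)).
exists B'; rewrite B'E.
have <- : B1 *m B1^T = B *m B^T.
  by rewrite /B1 trmx_mul mulmxA -(mulmxA B) HH mulmx1.
rewrite -[in RHS](hsubmxK B1) B1e tr_row_mx mul_row_col.
by rewrite mul0mx add0r.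
Qed.

(* A matrix square root of [BB^T], supported off the row space of [S W], is
   [1 - F + sqrt (s/(s-1)) (F - P)] for the orthogonal projections [F] and
   [P <= F] onto the row spaces of [W] and [S W]. *)
Lemma gram_of_frame (R : realType) (b b' n d : nat) (s M : R)
    (S : 'M[R]_(b, b')) (W : 'M[R]_(b', n)) :
  1 < s -> 0 < M -> S *m S^T = s%:M -> W *m W^T = M%:M -> (n <= d + b)%N ->
  exists B : 'M[R]_(n, d), B *m B^T =
    1%:M - ((s - 1) * M)^-1 *: (W^T *m (S^T *m S - 1%:M) *m W).
Proof.
move=> s1 M0 SS WW nd.
have s0 : 0 < s by exact: lt_trans s1.
pose F : 'M[R]_n := M^-1 *: (W^T *m W).
pose P : 'M[R]_n := (s * M)^-1 *: (W^T *m (S^T *m S) *m W).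
have MN0 : M != 0 by rewrite gt_eqF.
have sN0 : s != 0 by rewrite gt_eqF.
have s1N0 : s - 1 != 0 by rewrite gt_eqF ?subr_gt0.
have FW : F *m W^T = W^T.
  by rewrite /F -scalemxAl -mulmxA WW mul_mx_scalar scalerA mulVf ?scale1r.
have FF : F *m F = F.
  by rewrite {2}/F -scalemxAr mulmxA FW.
have FP : F *m P = P.
  by rewrite /P -scalemxAr !mulmxA FW.
have FT : F^T = F by rewrite /F linearZ /= trmx_mul trmxK.
have PT : P^T = P by rewrite /P linearZ /= !trmx_mul !trmxK !mulmxA.
have PF : P *m F = P by rewrite -[LHS]trmxK trmx_mul FT PT FP.
have PW : P *m (W^T *m S^T) = W^T *m S^T.
  rewrite /P -scalemxAl -!mulmxA (mulmxA W) WW mul_scalar_mx -!scalemxAr SS.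
  rewrite mul_mx_scalar -scalemxAr !scalerA.
  by rewrite [X in X *: _](_ : _ = 1) ?scale1r //; field; apply/andP.
have PP : P *m P = P.
  rewrite {2}/P -scalemxAr.
  have -> : W^T *m (S^T *m S) *m W = (W^T *m S^T) *m (S *m W).
    by rewrite !mulmxA.
  by rewrite (mulmxA P) PW /P !mulmxA.
pose t := Num.sqrt (s / (s - 1)).
have tt : t * t = s / (s - 1).
  by rewrite -expr2 sqr_sqrtr // divr_ge0 // ltW // subr_gt0.
pose B := 1%:M - F + t *: (F - P).
have BT : B^T = B.
  have FPT : (F - P)^T = F - P by rewrite raddfB /= FT PT.
  have IFT : (1%:M - F)^T = 1%:M - F by rewrite raddfB /= trmx1 FT.
  rewrite /B raddfD /= IFT; congr (_ + _).
  by rewrite -[in RHS]FPT linearZ.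
have BB : B *m B^T =
    1%:M - ((s - 1) * M)^-1 *: (W^T *m (S^T *m S - 1%:M) *m W).
  rewrite BT.
  have F1 : (1%:M - F) *m (1%:M - F) = 1%:M - F.
    by rewrite mulmxBr mulmx1 mulmxBl mul1mx FF subrr subr0.
  have F2 : (1%:M - F) *m (F - P) = 0.
    by rewrite mulmxBr !mulmxBl !mul1mx FF FP !subrr.
  have F3 : (F - P) *m (1%:M - F) = 0.
    by rewrite mulmxBr mulmx1 mulmxBl FF PF subrr.
  have F4 : (F - P) *m (F - P) = F - P.
    by rewrite mulmxBr !mulmxBl FF FP PF PP subrr subr0.
  have -> : B *m B = 1%:M - F + (s / (s - 1)) *: (F - P).
    rewrite /B; move: (1%:M - F) (F - P) F1 F2 F3 F4 => U V UU UV VU VV.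
    rewrite mulmxDl !mulmxDr -!scalemxAr -!scalemxAl UU UV VU VV.
    by rewrite !scaler0 addr0 add0r scalerA tt.
  rewrite -addrA; congr (_ + _).
  rewrite mulmxBr mulmx1 mulmxBl.
  have -> : W^T *m (S^T *m S) *m W = (s * M) *: P.
    by rewrite /P scalerA mulfV ?scale1r // mulf_neq0.
  have -> : W^T *m W = M *: F by rewrite /F scalerA mulfV ?scale1r.
  move: (F) (P) => U V; rewrite !scalerBr !scalerA opprB addrA.
  have -> : ((s - 1) * M)^-1 * (s * M) = s / (s - 1) by field; apply/andP.
  have -> : ((s - 1) * M)^-1 * M = s / (s - 1) - 1 by field; apply/andP.
  by rewrite scalerBl scale1r [- U + _]addrC.
(* The [b] independent columns of [(S *m W)^T] lie in the kernel of [B], so [B] has rank at most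
   [n - b <= d]. *)
have BW : B *m (W^T *m S^T) = 0.
  have FWS : F *m (W^T *m S^T) = W^T *m S^T by rewrite mulmxA FW.
  rewrite /B; move: (F) (P) (W^T *m S^T) PW FWS => U V Q VQ UQ.
  by rewrite mulmxDl -scalemxAl !mulmxBl mul1mx UQ VQ subrr scaler0 addr0.
rewrite -BB; apply: gram_rank.
have rk : \rank (W^T *m S^T) = b.
  rewrite -mxrank_tr trmx_mul !trmxK; apply/eqP; apply/row_freeP.
  exists ((s * M)^-1 *: (W^T *m S^T)).
  rewrite -scalemxAr !mulmxA -(mulmxA S) WW mul_mx_scalar -scalemxAl SS.
  rewrite -[s%:M]scalemx1 !scalerA [X in X *: _](_ : _ = 1) ?scale1r //.
  by field; apply/andP.
have := mulmx0_rank_max BW; rewrite rk => h.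
by rewrite -(leq_add2r b) (leq_trans h).
Qed.

(** * Flat matrices with orthogonal rows *)

(** Adding a row doubles the columns: the row [(u, -u)], [u] all ones, is orthogonal to every row of
    [(h, h)]. Starting from [m] columns gives any multiple of [2 ^ r]. *)
Lemma flat_orthogonal (R : realType) (r m : nat) :
  exists2 h : 'M[R]_(r, 2 ^ r * m),
    h *m h^T = (2 ^ r * m)%:R%:M & forall i j, `|h i j| <= 1.
Proof.
elim: r m => [|r IH] m; first by exists 0; [apply/matrixP => -[] | case].
have [h hh h1] := IH m.
have -> : (2 ^ r.+1 * m = 2 ^ r * m + 2 ^ r * m)%N.
  by rewrite expnS -mulnA mul2n addnn.
move: (2 ^ r * m)%N h hh h1 => M h hh h1.
pose u : 'rV[R]_M := const_mx 1.
have uu : u *m u^T = M%:R%:M.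
  apply/matrixP => i j; rewrite !mxE !ord1 eqxx.
  by under eq_bigr do rewrite !mxE mulr1; rewrite sumr_const card_ord.
pose h' : 'M[R]_(1 + r, M + M) := col_mx (row_mx u (- u)) (row_mx h h).
have hh' : h' *m h'^T = (M + M)%:R%:M.
  rewrite tr_col_mx !tr_row_mx mul_col_row !mul_row_col linearN /=.
  rewrite !mulNmx !mulmxN opprK uu hh !subrr.
  by rewrite [RHS]scalar_mx_block natrD raddfD raddfD.
exists h' => // i j; rewrite mxE; case: splitP => i' _.
  by rewrite mxE; case: splitP => j' _; rewrite !mxE ?normrN normr1.
by rewrite mxE; case: splitP.
Qed.

(** * The transversal design and its vectors *)

Lemma sum_enum_val {V : nmodType} {T : finType} (g : T -> V) :
  \sum_(u < #|T|) g (enum_val u) = \sum_t g t.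
Proof. by rewrite -big_enum_val. Qed.

Lemma sum_delta {R : pzSemiRingType} {T : finType} (t0 : T) (g : T -> R) :
  \sum_t (t == t0)%:R * g t = g t0.
Proof.
rewrite (bigD1 t0) //= eqxx mul1r big1 ?addr0 // => t /negbTE->.
by rewrite mul0r.
Qed.

Section TransversalDesign.
Context (R : realType) (X : finComUnitRingType) (A : finType) (f : A -> X).
Hypothesis f_unit : forall a a', a != a' -> f a - f a' \is a GRing.unit.

(* A flag ((a, c), x) stands for the point (a, c) together with the unique block
   with first coordinate x lying on it; [block_of] is that block. *)
Definition block_of (t : A * X * X) : X * X := (t.2, t.1.2 - f t.1.1 * t.2).

(** Columns are flags rather than points, so that the block-by-vector matrix Z factors as
    [incidence_mx *m sign_mx]. *)
Definition incidence_mx : 'M[R]_(#|{: X * X}|, #|{: A * X * X}|) :=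
  \matrix_(q, t) (enum_val q == block_of (enum_val t))%:R.

(** A block [(x, y)] contains one flag for each slope index [a], since [c = y + f a * x] is forced;
    a flag lies in only one block. *)
Lemma incidence_mx_row_orthogonal :
  incidence_mx *m incidence_mx^T = #|A|%:R%:M.
Proof.
apply/matrixP => q q'; rewrite !mxE.
under eq_bigr do rewrite !mxE.
rewrite (sum_enum_val (fun t => (enum_val q == block_of t)%:R *
  (enum_val q' == block_of t)%:R)).
have [<-|qq'] := eqVneq q q'; last first.
  rewrite mulr0n big1 // => t _.
  case: eqP => [<-|]; last by rewrite mul0r.
  by rewrite (inj_eq enum_val_inj) eq_sym (negbTE qq') mulr0.
rewrite mulr1n; case: (enum_val q) => x y.
rewrite -(pair_big xpredT xpredT (fun p z => ((x, y) == block_of (p, z))%:R *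
  ((x, y) == block_of (p, z))%:R)) /=.
rewrite -(pair_big xpredT xpredT (fun a c =>
  \sum_z ((x, y) == block_of (a, c, z))%:R *
         ((x, y) == block_of (a, c, z))%:R)) /=.
rewrite -[RHS]sumr_const; apply: eq_bigr => a _.
under eq_bigr => c _.
  under eq_bigr => z _.
    rewrite -natrM mulnb andbb /block_of xpair_eqE /= (eq_sym x).
    rewrite -mulnb natrM; over.
  rewrite sum_delta eq_sym subr_eq -[_%:R]mulr1; over.
by rewrite (sum_delta (y + f a * x) (fun=> 1)).
Qed.

Lemma incidence_mx_gram t t' :
  (incidence_mx^T *m incidence_mx) t t' =
    (block_of (enum_val t) == block_of (enum_val t'))%:R.
Proof.
rewrite mxE; under eq_bigr do rewrite !mxE.
by rewrite (sum_enum_val (fun q => (q == _)%:R * (q == _)%:R)) sum_delta.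
Qed.

(** Both equalities read [(f a - f a') * z = c - c'], for [z = x] and [z = x'], and the slope
    difference cancels. *)
Lemma concurrent_once (p p' : A * X) (x x' : X) : p != p' ->
  block_of (p, x) = block_of (p', x) -> block_of (p, x') = block_of (p', x') ->
  x' = x.
Proof.
case: p p' => [a c] [a' c'] pp' [/= e] [/= e'].
have aa' : a != a'.
  apply: contraNneq pp' => aa'; move: e; rewrite aa' => /addIr ->.
  by rewrite eqxx.
have slope z : c - f a * z = c' - f a' * z -> (f a - f a') * z = c - c'.
  by move=> /eqP; rewrite subr_eq => /eqP->; ring.
by apply: (mulrI (f_unit _ _ aa')); rewrite !slope.
Qed.

Variables (M : nat) (h : 'M[R]_(#|X|, M)).
Hypothesis h_orthogonal : h *m h^T = M%:R%:M.
Hypothesis h_le1 : forall i j, `|h i j| <= 1.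

(** Block diagonal, with one copy of [h] for each point. *)
Definition sign_mx : 'M[R]_(#|{: A * X * X}|, #|{: A * X * 'I_M}|) :=
  \matrix_(t, j) (((enum_val t).1 == (enum_val j).1)%:R *
                  h (enum_rank (enum_val t).2) (enum_val j).2).

Lemma sign_mx_row_orthogonal : sign_mx *m sign_mx^T = M%:R%:M.
Proof.
apply/matrixP => t t'; rewrite !mxE.
under eq_bigr do rewrite !mxE.
rewrite (sum_enum_val (fun j => (_ == j.1)%:R * h _ j.2 * ((_ == j.1)%:R * h _ j.2))).
rewrite -(inj_eq enum_val_inj).
case: (enum_val t) (enum_val t') => [p x] [p' x'].
rewrite -(pair_big xpredT xpredT (fun q y => (p == q)%:R * h (enum_rank x) y *
  ((p' == q)%:R * h (enum_rank x') y))) /=.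
under eq_bigr => q _.
  under eq_bigr => y _ do rewrite mulrACA (eq_sym p) -mulrA.
  rewrite -mulr_sumr; over.
rewrite sum_delta -mulr_sumr xpair_eqE (eq_sym p').
have := congr1 (fun B : 'M[R]_#|X| => B (enum_rank x) (enum_rank x')) h_orthogonal.
rewrite !mxE (inj_eq enum_rank_inj); under eq_bigr do rewrite mxE.
by move=> ->; case: eqP; case: eqP => _ _; rewrite ?mul1r ?mul0r.
Qed.

Lemma sum_flags (p : A * X) (phi : X -> R) (g : A * X * X -> R) :
  \sum_t (t.1 == p)%:R * phi t.2 * g t = \sum_x phi x * g (p, x).
Proof.
transitivity (\sum_q \sum_x (q == p)%:R * phi x * g (q, x)).
  by rewrite pair_big; apply: eq_bigr => -[].
under eq_bigr => q _.
  under eq_bigr do rewrite -mulrA.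
  rewrite -mulr_sumr; over.
by rewrite sum_delta.
Qed.

Lemma design_gramE i j :
  let p := (enum_val i).1 in let p' := (enum_val j).1 in
  (sign_mx^T *m (incidence_mx^T *m incidence_mx - 1%:M) *m sign_mx) i j =
  \sum_x h (enum_rank x) (enum_val i).2 * h (enum_rank x) (enum_val j).2 *
    ((block_of (p, x) == block_of (p', x))%:R - (p == p')%:R).
Proof.
move=> p p'.
pose phi x := h (enum_rank x) (enum_val i).2.
pose phi' x := h (enum_rank x) (enum_val j).2.
pose k (t t' : A * X * X) : R := (block_of t == block_of t')%:R - (t == t')%:R.
have kE t t' : (incidence_mx^T *m incidence_mx - 1%:M) t t' =
    k (enum_val t) (enum_val t').
  rewrite [LHS]mxE incidence_mx_gram [in X in _ + X]mxE [in X in _ - X]mxE.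
  by rewrite /k (inj_eq enum_val_inj).
rewrite mxE; under eq_bigr => t' _.
  rewrite [X in X * _]mxE; under eq_bigr do rewrite kE !mxE.
  rewrite (sum_enum_val (fun t => (t.1 == p)%:R * phi t.2 * k t _)) sum_flags.
  rewrite mxE mulrC; over.
rewrite (sum_enum_val (fun t' => (t'.1 == p')%:R * phi' t'.2 *
  \sum_x phi x * k (p, x) t')) sum_flags.
apply: eq_bigr => x' _; rewrite -mulrA mulrCA; congr (_ * _).
(* A block determines its first coordinate, so only flags with [x = x'] interact. *)
have kD x : phi x * k (p, x) (p', x') = (x == x')%:R *
    (phi x * ((block_of (p, x) == block_of (p', x))%:R - (p == p')%:R)).
  rewrite /k [_ == (p', x')]xpair_eqE.
  have [->|xx'] := eqVneq x x'; first by rewrite mul1r andbT.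
  by rewrite mul0r xpair_eqE (negbTE xx') andbF subrr mulr0.
by under eq_bigr do rewrite kD; rewrite sum_delta.
Qed.

(** At a common point the identity cancels every term. For distinct points at most one [x] gives a
    common block, leaving a single product of two entries of [h]. *)
Lemma design_gram_le1 i j :
  `|(sign_mx^T *m (incidence_mx^T *m incidence_mx - 1%:M) *m sign_mx) i j|
    <= (i != j)%:R.
Proof.
rewrite design_gramE.
set p := (enum_val i).1; set p' := (enum_val j).1.
have [pp'|pp'] := eqVneq p p'.
  by rewrite pp' big1 ?normr0 ?ler0n // => x _; rewrite eqxx subrr mulr0.
have -> /= : i != j by apply: contraNneq pp' => ij; rewrite /p /p' ij.
have [x0 /eqP e0|none] := pickP (fun x => block_of (p, x) == block_of (p', x)).
  rewrite (bigD1 x0) //= e0 eqxx subr0 mulr1 big1 ?addr0.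
    by rewrite normrM mulr_ile1.
  move=> x /eqP xx0; rewrite subr0; case: eqP => [e|]; last by rewrite mulr0.
  by case: xx0; exact: concurrent_once e0 e.
by rewrite big1 ?normr0 ?ler0n // => x _; rewrite none subr0 mulr0.
Qed.

Lemma design_coherence (n d : nat) :
  (1 < #|A|)%N -> (0 < M)%N -> (#|{: A * X * 'I_M}| <= n)%N ->
  (n <= d + #|{: X * X}|)%N ->
  exists2 x : 'I_n -> 'rV[R]_d, forall i, unit_vector (x i) &
    coherence x <= ((#|A|%:R - 1) * M%:R)^-1.
Proof.
move=> A1 M0 /subnKC <-; move: (n - _)%N => l nd.
(* The [l] zero columns fill up to [n] vectors; each yields a unit vector orthogonal to all the
   others. *)
pose W : 'M[R]_(_, _ + l) := row_mx sign_mx 0.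
have A1R : 1 < #|A|%:R :> R by rewrite ltr1n.
have M0R : 0 < M%:R :> R by rewrite ltr0n.
have WW : W *m W^T = M%:R%:M.
  by rewrite tr_row_mx mul_row_col mul0mx addr0 sign_mx_row_orthogonal.
have [B BB] := gram_of_frame _ _ _ _ _ _ _ _ _ A1R M0R
  incidence_mx_row_orthogonal WW nd.
have beta0 : 0 <= ((#|A|%:R - 1) * M%:R)^-1 :> R.
  by rewrite invr_ge0 mulr_ge0 ?ltW // subr_gt0.
have W1 i j : `|(W^T *m (incidence_mx^T *m incidence_mx - 1%:M) *m W) i j|
    <= (i != j)%:R.
  rewrite /W tr_row_mx mul_col_mx mul_col_row trmx0 !mul0mx !mulmx0.
  rewrite mxE; case: splitP => i' ii'; rewrite mxE; case: splitP => j' jj'.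
  - have -> : (i != j) = (i' != j') by rewrite -!val_eqE /= ii' jj'.
    exact: design_gram_le1.
  1-3: by rewrite mxE normr0 ler0n.
move: (W^T *m _ *m W) BB W1 => G BB G1.
have dotB i j : dotp (row i B) (row j B) =
    (i == j)%:R - ((#|A|%:R - 1) * M%:R)^-1 * G i j.
  have := congr1 (fun C : 'M[R]_(_, _) => C i j) BB; rewrite !mxE => <-.
  by apply: eq_bigr => t _; rewrite !mxE.
exists (fun i => row i B) => [i|].
  apply/unit_vectorE; rewrite dotB eqxx.
  have := G1 i i; rewrite eqxx normr_le0 => /eqP ->.
  by rewrite mulr0 subr0.
apply: bigmax_le => // i _; apply: bigmax_le => // j ij.
rewrite dotB (negbTE ij) add0r normrN normrM ger0_norm //.
by rewrite ler_piMr // (le_trans (G1 i j)) // ij.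
Qed.

End TransversalDesign.

(** * Choice of parameters and the limit in [d] *)

(** The ring is ['Z_r] with slopes [0, ..., s - 1]: their differences divide [s!] up to sign, hence
    are prime to [r = s! * t + 1]. [M] is the largest multiple of [2 ^ r] with
    [s * r * M <= d + k]. *)
Lemma thetaR_le_design (R : realType) (s t d k : nat) :
  let r := (s`! * t).+1 in let M := (2 ^ r * ((d + k) %/ (s * r * 2 ^ r)))%N in
  (1 < s)%N -> (0 < t)%N -> (k <= r ^ 2)%N -> (s * r * 2 ^ r <= d + k)%N ->
  thetaR R d k <= ((s%:R - 1) * M%:R)^-1.
Proof.
move=> r M s1 t0 kr rd.
have r1 : (1 < r)%N by rewrite ltnS muln_gt0 fact_gt0.
have cX : #|'Z_r| = r by rewrite card_ord Zp_cast.
have [h hh h1] := flat_orthogonal R #|'Z_r| ((d + k) %/ (s * r * 2 ^ r)).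
pose f (a : 'I_s) : 'Z_r := a%:R.
have f_unit a a' : a != a' -> f a - f a' \is a GRing.unit.
  wlog le_a : a a' / (a <= a')%N => [th|aa'].
    have [|/ltnW] := leqP a a'; first exact: th.
    move=> le_a aa'; rewrite -opprB unitrN; apply: th => //.
    by rewrite eq_sym.
  rewrite -opprB unitrN /f -natrB // unitZpE //.
  have : (0 < a' - a <= s)%N.
    rewrite subn_gt0 ltn_neqAle le_a aa' /=.
    by rewrite (leq_trans (leq_subr _ _)) // ltnW.
  move=> /dvdn_fact => /dvdn_mulr => /(_ t) /dvdnP[q qE].
  by rewrite /r qE coprime_sym -addn1 /coprime gcdnMDl gcdn1.
have M0 : (0 < M)%N.
  by rewrite muln_gt0 expn_gt0 divn_gt0 // !muln_gt0 expn_gt0 (ltnW s1).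
have /= := design_coherence R 'Z_r 'I_s f f_unit _ h hh h1 (d + k) d.
rewrite !card_prod !card_ord Zp_cast // -/M => /(_ s1 M0) [||x ux cx].
- rewrite /M mulnA [X in (_ <= X)%N](divn_eq (d + k) (s * r * 2 ^ r)).
  by rewrite mulnC leq_addr.
- by rewrite leq_add2l -/r mulnn.
- exact: le_trans (thetaR_le ux) cx.
Qed.

Theorem theorem3p12 (R : realType) (eps : R) (eps_gt0 : 0 < eps) :
  exists k0 : nat, forall k : nat, (0 < k)%N -> (k0 <= k)%N ->
    exists o : nat -> R,
      (o d @[d --> \oo] --> (0 : R)) /\
      (forall d : nat, (0 < d)%N ->
        thetaR R d k <=
          (1 + o d) * ((1 + eps) * Num.sqrt k%:R / d%:R)).
Proof.
(* Large enough that [s / (s - 1) < 1 + eps / 2]. *)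
pose s := (Num.truncn (2 / eps)).+3.
have s1 : (1 < s)%N by [].
have s1eps : 2 / eps < s%:R - 1.
  apply: lt_le_trans (truncnS_gt _) _.
  by rewrite lerBrDr natr1 ler_nat.
(* [F] will bound the excess of [r] over [sqrt k]. [K] solves [(1 + eps / 2) * F = eps / 2 * K], so
   [sqrt k > K] absorbs that excess in the remaining [eps / 2]. *)
pose F : R := s`!%:R + 1.
pose K : R := (1 + eps / 2) * F * (2 / eps).
exists (Num.truncn (K ^+ 2)).+1 => k k_gt0 kK.
pose b : R := (1 + eps) * Num.sqrt k%:R.
have b_gt0 : 0 < b by rewrite mulr_gt0 ?sqrtr_gt0 ?ltr0n // addr_gt0.
have F0 : 0 < F by rewrite ltr_wpDl ?ler0n.
have e20 : 0 < eps / 2 by rewrite divr_gt0.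
have K0 : 0 < K by apply: mulr_gt0; rewrite ?divr_gt0 ?mulr_gt0 // addr_gt0.
have Kk : K < Num.sqrt k%:R.
  rewrite -[K](ger0_norm (ltW K0)) -sqrtr_sqr ltr_sqrt ?ltr0n //.
  by apply: lt_le_trans (truncnS_gt _) _; rewrite ler_nat.
set q : R := Num.sqrt k%:R in b b_gt0 Kk *.
have q0 : 0 < q by exact: lt_trans Kk.
have f0 : 0 < s`!%:R :> R by rewrite ltr0n fact_gt0.
pose t := (Num.truncn (q / s`!%:R)).+1.
pose r := (s`! * t).+1; pose N := (s * r * 2 ^ r)%N.
have qr : q < r%:R.
  rewrite /r -natr1 natrM ltr_wpDr // mulrC -ltr_pdivrMr //.
  exact: truncnS_gt.
have rq : r%:R <= q + F.
  rewrite /r -natr1 natrM /t -natr1 mulrDr mulr1 /F addrA !lerD2r.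
  by rewrite mulrC -ler_pdivlMr // truncn_le divr_ge0 ?ltW.
have kr : (k <= r ^ 2)%N.
  rewrite -(ler_nat R) natrX -[k%:R]sqr_sqrtr ?ler0n // -/q.
  by rewrite ler_sqr ?nnegrE ?ler0n ?ltW.
have s1R : 0 < s%:R - 1 :> R by rewrite subr_gt0 ltr1n.
(* The design gives roughly [a / d]; the strict gap [a < b] pays for rounding [M] down. *)
pose a : R := s%:R * r%:R / (s%:R - 1).
have ab : a < b.
  have inv : (s%:R - 1)^-1 < eps / 2.
    by rewrite -[eps / 2]invrK ltf_pV2 ?posrE ?invr_gt0 ?divr_gt0 // invf_div.
  have -> : a = (1 + (s%:R - 1)^-1) * r%:R by rewrite /a; field; rewrite gt_eqF.
  have r0 : 0 < r%:R :> R by rewrite ltr0n.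
  have h1 : (1 + (s%:R - 1)^-1) * r%:R < (1 + eps / 2) * r%:R.
    by rewrite ltr_pM2r // ltrD2l.
  have h2 : (1 + eps / 2) * r%:R <= (1 + eps / 2) * (q + F).
    by rewrite ler_pM2l // addr_gt0 // divr_gt0.
  have h3 : (1 + eps / 2) * F = eps / 2 * K by rewrite /K; field; rewrite gt_eqF.
  have h4 : eps / 2 * K < eps / 2 * q by rewrite ltr_pM2l // divr_gt0.
  by rewrite /b; lra.
(* For [d >= D] one has [a * d <= b * (d - N)], while the rounding loses at most [N] vectors. *)
pose D := ((Num.truncn (b * N%:R / (b - a))).+1 + N)%N.
have thetaD d : (D <= d)%N -> thetaR R d k <= b / d%:R.
  move=> Dd; have Nd : (N <= d)%N by rewrite (leq_trans _ Dd) ?leq_addl.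
  have N0 : (0 < N)%N by rewrite !muln_gt0 expn_gt0.
  have d0 : 0 < d%:R :> R by rewrite ltr0n (leq_trans N0).
  have Ndk : (N <= d + k)%N by rewrite (leq_trans Nd) ?leq_addr.
  apply: le_trans (thetaR_le_design R s t d k s1 isT kr Ndk) _.
  rewrite -/r -/N; set m := ((d + k) %/ N)%N.
  have m0 : 0 < m%:R :> R by rewrite ltr0n divn_gt0.
  have mN : d%:R - N%:R <= m%:R * N%:R :> R.
    rewrite lerBlDr -natrM -natrD ler_nat -mulSnr (leq_trans (leq_addr k d)) //.
    exact/ltnW/ltn_ceil.
  have M0 : 0 < (2 ^ r * m)%:R :> R by rewrite natrM mulr_gt0 // ltr0n expn_gt0.
  have big : b * N%:R <= d%:R * (b - a).
    rewrite -ler_pdivrMr ?subr_gt0 // ltW //.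
    apply: lt_le_trans (truncnS_gt _) _.
    by rewrite ler_nat (leq_trans _ Dd) // leq_addr.
  rewrite ler_pdivlMr // mulrC ler_pdivrMr ?mulr_gt0 //.
  have aE : a * (s%:R - 1) = s%:R * r%:R by rewrite /a divfK // gt_eqF.
  have mNE : m%:R * N%:R = a * ((s%:R - 1) * (2 ^ r * m)%:R).
    by rewrite mulrA aE /N !natrM; ring.
  have sM0 : 0 < (s%:R - 1) * (2 ^ r * m)%:R :> R by rewrite mulr_gt0.
  have a0 : 0 < a by rewrite divr_gt0 // mulr_gt0 // ltr0n.
  rewrite -(ler_pM2l a0) mulrCA -mNE.
  have : b * (d%:R - N%:R) <= b * (m%:R * N%:R) by rewrite ler_pM2l.
  by move: big; lra.
(* Below [D] the error term is chosen so that the right side equals [b / d + thetaR R d k]; from [D]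
   on it is 0. *)
exists (fun d => if (d < D)%N then thetaR R d k * d%:R / b else 0); split.
  apply: cvg_near_cst; exists D => // d /=.
  by rewrite leqNgt => /negbTE ->.
move=> d d0; rewrite -/q -/b; have dR : 0 < d%:R :> R by rewrite ltr0n.
case: ltnP => [_|Dd]; last by rewrite addr0 mul1r thetaD.
have -> : (1 + thetaR R d k * d%:R / b) * (b / d%:R) = b / d%:R + thetaR R d k.
  by field; rewrite !gt_eqF.
by rewrite lerDr divr_ge0 ?ltW.
Qed.
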